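(* Let $\phi\in\mathcal{A}[\delta,M]$, $a\in V$, and put $L:=\frac{2(\delta_T+M)}{1-\varkappa-2\delta_T}$. Assume (stability) that there is a constant $\ell<1$ such that for each partition $\pi$ of $\mathbb{T}$, $\Phi^\pi$ is Lipschitz continuous on $\mathcal{P}_\pi[\phi,a,L]$ with constant $\ell$ (uniform in $\pi$). For each partition $\pi$ of $\mathbb{T}$, let $y^\pi$ be the numerical scheme associated to $\phi$ with respect to $\pi$, with $y^\pi_0=a$. Then, for any $y\in\mathcal{P}[\phi,a,L]$, $$\|y^\pi-y\|_\infty\le\frac{A}{1-\ell}\,\mu_{0,T}(\pi)\,\omega_{0,T},\qquad A:=\frac{2(\delta_T(1+L)+M)}{1-\varkappa}.$$ Besides, $\{y^\pi\}_\pi$ is a Cauchy sequence with respect to $\|\cdot\|_\infty$ as $\operatorname{Mesh}\pi\to0$, with $$\|y^\sigma-y^\pi\|_\infty\le\frac{2A}{1-\ell}\max\{\mu_{0,T}(\pi),\mu_{0,T}(\sigma)\}\,\omega_{0,T}$$ for any two partitions $\sigma$ and $\pi$ of $\mathbb{T}$. In consequence, $\mathcal{P}[\phi,a]=\{y\}$ with $y=\lim_\pi y^\pi$.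
   Context: Setting. $V$ is a Banach space with norm $|\cdot|$, $\mathfrak{i}$ is the identity map of $V$, $\mathcal{C}(V,V)$ is the set of continuous maps, $\|f\|_\infty=\sup_a|f(a)|$. $T>0$, $\mathbb{T}=[0,T]$, $\mathbb{T}_+^2=\{(s,t)\in\mathbb{T}^2: s\le t\}$, $\mathbb{T}_+^3=\{(r,s,t)\in\mathbb{T}^3: r\le s\le t\}$. $\delta,\varpi:\mathbb{R}_+\to\mathbb{R}_+$ are non-decreasing with $\delta(0)=\varpi(0)=0$; $\delta_t:=\delta(t)$. $\omega:\mathbb{T}_+^2\to\mathbb{R}_+$ is a control: $\omega_{r,s}+\omega_{s,t}\le\omega_{r,t}$ on $\mathbb{T}_+^3$, $\omega_{s,s}=0$, and $\omega$ is continuous close to its diagonal. Standing assumptions: for some $\varkappa\in(0,1)$, $2\varpi(x/2)\le\varkappa\varpi(x)$ for all $x\ge0$; and $\varkappa+2\delta_T<1$. For $f:V\to V$, $\operatorname{osc}(f,h)=\sup_{|a-b|\le h}|f(a)-f(b)|$. A map $\chi:\mathbb{T}_+^2\to\mathcal{C}(V,V)$, $(s,t)\mapsto\chi_{t,s}$, is of class $\mathcal{O}$ if for some $C\ge0$: $\operatorname{osc}(\chi_{t,s},\lambda\varpi(\omega_{r,s}))\le C\delta_T(1+\lambda)\varpi(\omega_{r,t})$ for all $(r,s,t)\in\mathbb{T}_+^3$, $\lambda\ge0$; the smallest such $C$ is $\|\chi\|_{\mathcal{O}}$. $\mathcal{F}[\delta]$ is the class of families $\phi=\{\phi_{t,s}\}_{(s,t)\in\mathbb{T}_+^2}$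 of maps $V\to V$ with $\phi_{t,s}=\mathfrak{i}+\widehat{\phi}_{t,s}$, $\widehat\phi$ of class $\mathcal{O}$, $\|\widehat\phi\|_{\mathcal{O}}\le1$ and $\|\widehat\phi_{t,s}\|_\infty\le\delta_{t-s}$ for all $(s,t)\in\mathbb{T}_+^2$. For $M\ge0$, $\mathcal{A}[\delta,M]$ is the set of $\phi\in\mathcal{F}[\delta]$ such that $\|\mathfrak{d}\phi_{t,s,r}\|_\infty\le M\varpi(\omega_{r,t})$ on $\mathbb{T}_+^3$, where $\mathfrak{d}\phi_{t,s,r}=\phi_{t,s}\circ\phi_{s,r}-\phi_{t,r}$ (such $\phi$ are called almost flows). For a partition $\pi=\{t_i\}_{i=0}^n$ of $\mathbb{T}$ ($0=t_0<\dots<t_n=T$), $\mathcal{P}_\pi[\phi,a,K]$ is the set of $V$-valued families $\{y_{t_k}\}_{k=0}^n$ with $y_0=a$ and $|y_{t_j}-\phi_{t_j,t_i}(y_{t_i})|\le K\varpi(\omega_{t_i,t_j})$ for all $0\le i\le j\le n$. $\mathcal{P}[\phi,a,K]$ is the set of $y\in\mathcal{C}(\mathbb{T},V)$ with $y_0=a$ and $|y_t-\phi_{t,s}(y_s)|\le K\varpi(\omega_{s,t})$ on $\mathbb{T}_+^2$; $\mathcal{P}[\phi,a]=\bigcup_{K\ge0}\mathcal{P}[\phi,a,K]$. The numerical scheme is $y^\pi_0=a$, $y^\pi_{t_{k+1}}=\phi_{t_{k+1},t_k}(y^\pi_{t_k})$. Convention on projection/interpolation: a path in $\mathcal{P}[\phi,a]$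 (or a family on a finer partition) is projected onto $\pi$ by restriction to the points of $\pi$, and an element of $\mathcal{P}_\pi[\phi,a]$ is extended by linear interpolation to an element of $\mathcal{C}([0,T],V)$, denoted by the same symbol; with this convention, $\|\cdot\|_\infty$ denotes the uniform norm. For $t_i\le t_j$ in $\pi$, $\Phi^\pi_{t_i,t_j}(y)=\sum_{k=i}^{j-1}\widehat\phi_{t_{k+1},t_k}(y_{t_k})$; $\Phi^\pi$ is viewed as the map $y\mapsto\{\Phi^\pi_{0,t_j}(y)\}_{j}$, Lipschitz continuity being with respect to the uniform norm. Finally $\mu_{0,T}(\pi)=\max_{0\le i<n}\varpi(\omega_{t_i,t_{i+1}})/\omega_{t_i,t_{i+1}}$, and $\operatorname{Mesh}\pi=\max_i(t_{i+1}-t_i)$; limits over $\pi$ are limits as $\operatorname{Mesh}\pi\to0$.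
   Formalization: The bound on y^σ−y^π is taken at the common points of σ and π, and that on y^π−y at the points of π (false for interpolated paths on [0,T]); the Cauchy, limit and P[φ,a]={y} claims additionally assume δ(x)→0 as x→0+, without which they fail. *)

(* Defs.v *)
From mathcomp Require Import all_boot all_order all_algebra.
From mathcomp Require Import all_classical all_reals all_analysis.

Set Implicit Arguments.
Unset Strict Implicit.
Unset Printing Implicit Defensive.

Import Order.TTheory GRing.Theory Num.Theory.
Import numFieldNormedType.Exports.

Local Open Scope classical_set_scope.
Local Open Scope ring_scope.

(* Functions of a time in [0, T], of a pair in T_+^2 or of a nonnegative real
   are total functions on R whose values outside that domain are never used.
   Two-time families of maps are written phi t s, with the later time first
   (phi_{t,s}), controls omega s t, with the earlier time first (omega_{s,t}). *)

Definition simplex2 (R : realType) (T s t : R) : bool :=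
  [&& 0 <= s, s <= t & t <= T].

Definition simplex3 (R : realType) (T r s t : R) : bool :=
  [&& 0 <= r, r <= s, s <= t & t <= T].

Definition unorm (R : realType) (V : normedModType R) (X : Type)
    (A : set X) (f : X -> V) : \bar R :=
  ereal_sup [set (`|f x|)%:E | x in A].

Definition nondecreasing_null (R : realType) (f : R -> R) : Prop :=
  [/\ f 0 = 0,
      forall x, 0 <= x -> 0 <= f x
    & forall x y, 0 <= x -> x <= y -> f x <= f y].

(* By compactness of [0, T], a neighbourhood of the diagonal of T_+^2 is the
   same as a strip t - s < eta. *)
Definition continuous_near_diagonal (R : realType) (T : R)
    (omega : R -> R -> R) : Prop :=
  exists2 eta : R, 0 < eta &
    {within [set p : R * R | simplex2 T p.1 p.2 && (p.2 - p.1 < eta)],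
      continuous (fun p : R * R => omega p.1 p.2)}.

Definition control (R : realType) (T : R) (omega : R -> R -> R) : Prop :=
  [/\ forall s t, simplex2 T s t -> 0 <= omega s t,
      forall r s t, simplex3 T r s t -> omega r s + omega s t <= omega r t,
      forall s, 0 <= s <= T -> omega s s = 0
    & continuous_near_diagonal T omega].

Definition osc (R : realType) (V : normedModType R) (f : V -> V) (h : R) :
    \bar R :=
  ereal_sup [set (`|f p.1 - f p.2|)%:E |
             p in [set p : V * V | `|p.1 - p.2| <= h]].

Definition O_bound (R : realType) (V : normedModType R) (T : R)
    (delta varpi : R -> R) (omega : R -> R -> R) (chi : R -> R -> V -> V)
    (C : R) : Prop :=
  0 <= C /\
  forall r s t lambda, simplex3 T r s t -> 0 <= lambda ->
    (osc (chi t s) (lambda * varpi (omega r s))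
       <= (C * delta T * (1 + lambda) * varpi (omega r t))%:E)%E.

Definition classO (R : realType) (V : normedModType R) (T : R)
    (delta varpi : R -> R) (omega : R -> R -> R) (chi : R -> R -> V -> V) :
    Prop :=
  (forall s t, simplex2 T s t -> continuous (chi t s)) /\
  exists C, O_bound T delta varpi omega chi C.

Definition normO (R : realType) (V : normedModType R) (T : R)
    (delta varpi : R -> R) (omega : R -> R -> R) (chi : R -> R -> V -> V) : R :=
  inf [set C | O_bound T delta varpi omega chi C].

(* phi = id + hat phi *)
Definition hat (R : realType) (V : normedModType R) (phi : R -> R -> V -> V) :
    R -> R -> V -> V :=
  fun t s a => phi t s a - a.

Definition classF (R : realType) (V : normedModType R) (T : R)
    (delta varpi : R -> R) (omega : R -> R -> R) (phi : R -> R -> V -> V) :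
    Prop :=
  [/\ classO T delta varpi omega (hat phi),
      normO T delta varpi omega (hat phi) <= 1
    & forall s t, simplex2 T s t ->
        (unorm setT (hat phi t s) <= (delta (t - s))%:E)%E].

Definition almost_flow (R : realType) (V : normedModType R) (T : R)
    (delta varpi : R -> R) (omega : R -> R -> R) (M : R)
    (phi : R -> R -> V -> V) : Prop :=
  classF T delta varpi omega phi /\
  forall r s t, simplex3 T r s t ->
    (unorm setT (fun a => (phi t s (phi s r a) - phi t r a)%R)
       <= (M * varpi (omega r t))%:E)%E.

(* Partitions of [0, T] are the sequences pi with itv_partition 0 T pi; the
   initial point t_0 = 0 is not listed in pi. For such a pi, t_k = tpt T pi k
   for k <= size pi, and tpt T pi k = T beyond. *)
Definition tpt (R : realType) (T : R) (pi : seq R) (k : nat) : R :=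
  nth T (0 :: pi) k.

Definition points (R : realType) (pi : seq R) : set R := [set` 0 :: pi].

(* A family indexed by the points of pi is a function on R of which only the
   values on points pi matter; hence the projection onto pi of a path, or of a
   family on a finer partition, is that same function. *)
Definition P_part (R : realType) (V : normedModType R) (varpi : R -> R)
    (omega : R -> R -> R) (pi : seq R) (phi : R -> R -> V -> V) (a : V)
    (K : R) : set (R -> V) :=
  [set y | y 0 = a /\
    forall s t, points pi s -> points pi t -> s <= t ->
      `|y t - phi t s (y s)| <= K * varpi (omega s t)].

Definition P_bound (R : realType) (V : normedModType R) (T : R)
    (varpi : R -> R) (omega : R -> R -> R) (phi : R -> R -> V -> V) (a : V)
    (K : R) : set (R -> V) :=
  [set y | [/\ {within `[0, T], continuous y}, y 0 = a
    & forall s t, simplex2 T s t ->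
        `|y t - phi t s (y s)| <= K * varpi (omega s t)]].

Definition P_path (R : realType) (V : normedModType R) (T : R)
    (varpi : R -> R) (omega : R -> R -> R) (phi : R -> R -> V -> V) (a : V) :
    set (R -> V) :=
  \bigcup_(K in [set K | 0 <= K]) P_bound T varpi omega phi a K.

Fixpoint scheme (R : realType) (V : normedModType R) (T : R)
    (phi : R -> R -> V -> V) (a : V) (pi : seq R) (k : nat) : V :=
  if k is j.+1 then
    phi (tpt T pi j.+1) (tpt T pi j) (scheme T phi a pi j)
  else a.

(* For 0 <= t < T, the k below is the index with t_k <= t < t_{k+1}. For t = T
   it is size pi, and the quotient is 0 / 0 = 0. *)
Definition interpolation (R : realType) (V : normedModType R) (T : R)
    (pi : seq R) (u : nat -> V) (t : R) : V :=
  let k := count (fun x => x <= t) pi in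
  let tk := tpt T pi k in
  let tk1 := tpt T pi k.+1 in
  u k + ((t - tk) / (tk1 - tk)) *: (u k.+1 - u k).

Definition scheme_path (R : realType) (V : normedModType R) (T : R)
    (phi : R -> R -> V -> V) (a : V) (pi : seq R) : R -> V :=
  interpolation T pi (scheme T phi a pi).

Definition Phi (R : realType) (V : normedModType R) (T : R)
    (phi : R -> R -> V -> V) (pi : seq R) (i j : nat) (y : R -> V) : V :=
  \sum_(i <= k < j) hat phi (tpt T pi k.+1) (tpt T pi k) (y (tpt T pi k)).

Definition Phi_lipschitz (R : realType) (V : normedModType R) (T : R)
    (phi : R -> R -> V -> V) (pi : seq R) (A : set (R -> V)) (l : R) : Prop :=
  forall y z, A y -> A z ->
    (unorm [set j | (j <= size pi)%N]
       (fun j => (Phi T phi pi 0 j y - Phi T phi pi 0 j z)%R)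
     <= l%:E * unorm (points pi) (fun t => (y t - z t)%R))%E.

(* When omega_{t_i,t_{i+1}} = 0, the i-th ratio is 0 / 0 = 0. *)
Definition mu (R : realType) (T : R) (varpi : R -> R) (omega : R -> R -> R)
    (pi : seq R) : R :=
  \big[Num.max/0]_(i < size pi)
    (varpi (omega (tpt T pi i) (tpt T pi i.+1))
       / omega (tpt T pi i) (tpt T pi i.+1)).

Definition mesh (R : realType) (T : R) (pi : seq R) : R :=
  \big[Num.max/0]_(i < size pi) (tpt T pi i.+1 - tpt T pi i).

(* The filter of limits over partitions of [0, T] as their mesh tends to 0. *)
Definition mesh_to0 (R : realType) (T : R) : set_system (seq R) :=
  [set B | exists2 eta : R, 0 < eta &
     forall pi, itv_partition 0 T pi -> mesh T pi < eta -> B pi].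

#[global] Instance mesh_to0_filter (R : realType) (T : R) : Filter (mesh_to0 T).
Proof.
split.
- by exists 1 => //; exact: ltr01.
- move=> P Q [e e0 Pe] [d d0 Qd]; exists (Num.min e d).
    by rewrite lt_min e0.
  by move=> pi piT; rewrite lt_min => /andP[me md]; split; [exact: Pe|exact: Qd].
- by move=> P Q PQ [e e0 Pe]; exists e => // pi piT me; apply: PQ; exact: Pe.
Qed.

(* Main.v *)
Require Import Defs.
From mathcomp Require Import all_boot all_order all_algebra.
From mathcomp Require Import all_classical all_reals all_analysis.
From mathcomp Require Import lra ring.
Import Order.TTheory GRing.Theory Num.Theory.
Import numFieldNormedType.Exports.
Local Open Scope classical_set_scope.
Local Open Scope ring_scope.

(** Call defect of y between s and t the quantity
    |y_t - phi_{t,s}(y_s)|. Inserting two intermediate times s <= s' between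
    r and t such that omega_{r,s} and omega_{s',t} are at most
    omega_{r,t} / 2 turns a defect bound K varpi(omega) into the bound
    kappa K + 2 (delta_T (1 + K) + M), up to the defect between s and s'
    (davie_step). The constant L is the fixed point of this affine recursion,
    of slope kappa + 2 delta_T < 1; the same equation says A = L. Two facts
    follow. Along a partition, s and s' can be consecutive points, between
    which the scheme has no defect, so that the scheme belongs to P_pi[phi,a,L]
    (discrete_davie). For a path with any constant K, s and s' can be taken
    arbitrarily close, and iteration lowers K to L (defect_le_L); thus P[phi,a]
    is P[phi,a,L].

    Next, an element y of P_pi[phi,a,L] is the starting point a plus Phi^pi(y)
    plus the sum of its one-step defects, which is at most
    L sum_i varpi(omega_{t_i,t_{i+1}}) <= L mu(pi) omega_{0,T} by
    superadditivity of omega. The scheme has no one-step defects, so stability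
    bounds its distance to y by ell times this distance plus
    L mu(pi) omega_{0,T} (scheme_stability). With y a path this is the first
    estimate; with y the scheme along a common refinement of two partitions it
    gives the second one (scheme_dist_le).

    For convergence, halving x multiplies varpi(x) / x by at most kappa, so
    that varpi(x) / x tends to 0 with x (varpi_sublinear), and by compactness
    omega is uniformly small near the diagonal; hence mu(pi) tends to 0 with
    the mesh. As delta tends to 0 at 0, the paths and the interpolated schemes
    also vary little between neighbouring partition points, and the estimates
    extend from partition points to all times (scheme_near). The schemes are
    therefore uniformly Cauchy; their limit inherits the defect bound, since
    partitions containing two given times can be arbitrarily fine, and every
    element of P[phi,a] is approximated by the same schemes. *)

(** * Uniform norm and partitions *)

Section UniformNorm.
Context {R : realType} {V : normedModType R} {X : Type}.
Implicit Types (A : set X) (f : X -> V).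

Lemma unorm_le A f (c : R) :
  (forall x, A x -> `|f x| <= c) -> (unorm A f <= c%:E)%E.
Proof.
by move=> fc; apply: ge_ereal_sup => _ [x Ax <-]; rewrite lee_fin; exact: fc.
Qed.

Lemma le_unorm A f x : A x -> (`|f x|%:E <= unorm A f)%E.
Proof. by move=> Ax; apply: ereal_sup_ubound; exists x. Qed.

Lemma unorm_leP A f (c : R) x : (unorm A f <= c%:E)%E -> A x -> `|f x| <= c.
Proof.
by move=> fc Ax; rewrite -lee_fin; apply: le_trans fc; exact: le_unorm.
Qed.

End UniformNorm.

Section Partitions.
Context {R : realType} {T : R}.
Implicit Types (pi : seq R) (x t eta : R).

Lemma tpt_size pi : itv_partition 0 T pi -> tpt T pi (size pi) = T.
Proof. by case=> _ /eqP <-; rewrite /tpt nth_last. Qed.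

Lemma tpt_lt pi i j : itv_partition 0 T pi -> (i < j)%N ->
  (j <= size pi)%N -> tpt T pi i < tpt T pi j.
Proof.
move=> [pi_lt _] ij jn.
have /= -> // := @lt_sorted_ltn_nth _ _ T (0 :: pi) pi_lt.
by rewrite inE /= ltnS (leq_trans (ltnW ij)).
Qed.

Lemma tpt_le pi i j : itv_partition 0 T pi -> (i <= j)%N ->
  (j <= size pi)%N -> tpt T pi i <= tpt T pi j.
Proof.
move=> piT; rewrite leq_eqVlt => /predU1P[-> //|ij jn].
by apply/ltW/tpt_lt.
Qed.

Lemma tpt_itv pi k : itv_partition 0 T pi -> (k <= size pi)%N ->
  0 <= tpt T pi k <= T.
Proof.
move=> piT kn; apply/andP; split; first exact: (@tpt_le pi 0 k piT).
by rewrite -[leRHS](tpt_size pi) // tpt_le.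
Qed.

Lemma tpt_simplex2 pi k : itv_partition 0 T pi -> (k < size pi)%N ->
  simplex2 T (tpt T pi k) (tpt T pi k.+1).
Proof.
move=> piT kn; rewrite /simplex2 (tpt_le pi k k.+1 piT) ?leqnSn //.
have /andP[-> _] := tpt_itv pi k piT (ltnW kn).
by have /andP[_ ->] := tpt_itv pi k.+1 piT kn.
Qed.

Lemma points_tpt pi k : (k <= size pi)%N -> points pi (tpt T pi k).
Proof. by move=> kn; rewrite /points /= mem_nth. Qed.

Lemma pointsP pi x : points pi x ->
  exists2 k, (k <= size pi)%N & x = tpt T pi k.
Proof.
move=> xpi; exists (index x (0 :: pi)); last by rewrite /tpt nth_index.
by rewrite -ltnS -[ltnRHS]/(size (0 :: pi)) index_mem.
Qed.

Lemma points_itv pi x : itv_partition 0 T pi -> points pi x -> 0 <= x <= T.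
Proof. by move=> piT /pointsP[k kn ->]; exact: tpt_itv. Qed.

Lemma points0 pi : points pi 0.
Proof. by rewrite /points /= mem_head. Qed.

Lemma count_tpt pi k : itv_partition 0 T pi -> (k <= size pi)%N ->
  count (fun x => x <= tpt T pi k) pi = k.
Proof.
move=> piT kn; apply: succn_inj.
rewrite -[RHS](@count_le_nth _ _ T (0 :: pi) k) //=; last by case: piT.
by rewrite -/(tpt T pi k); have /andP[-> _] := tpt_itv pi k piT kn.
Qed.

Lemma count_itv pi t (k := count (fun x => x <= t) pi) :
    itv_partition 0 T pi -> 0 <= t < T ->
  (k < size pi)%N /\ tpt T pi k <= t < tpt T pi k.+1.
Proof.
move=> piT /andP[t0 tT].
have pi_le : sorted <=%O (0 :: pi).
  by apply: (@sub_sorted _ <%O _ _ (0 :: pi) piT.1) => x y; exact: ltW.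
have kE : count (fun x => x <= t) (0 :: pi) = k.+1 by rewrite /= t0.
have kn : (k < size pi)%N.
  rewrite ltn_neqAle count_size andbT; apply/eqP => kE'.
  have := @nth_count_le _ _ t T _ k pi_le; rewrite kE ltnSn => /(_ isT).
  by rewrite -/(tpt T pi k) kE' tpt_size // leNgt tT.
split=> //; apply/andP; split.
  by apply: nth_count_le => //; rewrite kE.
by apply: nth_count_gt => //; rewrite kE leqnn ltnS.
Qed.

(** This is how a point of a fine grid just after a partition point bounds the
    length of the interval that starts there. *)
Lemma tpt_gap pi k x : itv_partition 0 T pi -> points pi x ->
  tpt T pi k < x -> tpt T pi k.+1 <= x.
Proof.
move=> piT /pointsP[j jn ->] kj.
have [jk|kj'] := leqP j k; last exact: tpt_le.
have [kn|nk] := leqP k (size pi).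
  by have := tpt_le pi _ _ piT jk kn; move: kj; rewrite ltNge => /negP.
have /andP[_] := tpt_itv pi j piT jn.
by rewrite {1}/tpt leNgt => /negP; case; move: kj; rewrite {1}/tpt nth_default.
Qed.

Lemma mesh_ge pi k : (k < size pi)%N ->
  tpt T pi k.+1 - tpt T pi k <= mesh T pi.
Proof.
by move=> kn; exact: (le_bigmax _ (fun i : 'I_(size pi) => _) (Ordinal kn)).
Qed.

(** Sort a uniform grid of step eta / 2 together with T and the prescribed
    points: the next grid point after any point is at most one step away. *)
Lemma fine_partition eta (l : seq R) : 0 < T -> 0 < eta ->
    {in l, forall x, 0 <= x <= T} ->
  exists pi, [/\ itv_partition 0 T pi, mesh T pi < eta
               & {in l, forall x, points pi x}].
Proof.
move=> T0 eta0 lT; pose h := eta / 2.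
have h0 : 0 < h by rewrite divr_gt0.
pose N := (Num.truncn (T / h)).+1.
pose s := T :: l ++ [seq h * i%:R | i <- iota 0 N.+1].
pose pi := sort <=%O (undup [seq x <- s | 0 < x <= T]).
have mem_pi x : (x \in pi) = (x \in s) && (0 < x <= T).
  by rewrite mem_sort mem_undup mem_filter andbC.
have pi_lt : path <%O 0 pi.
  rewrite lt_path_sortedE sort_lt_sorted undup_uniq andbT.
  by apply/allP => x; rewrite mem_pi => /and3P[].
have Tpi : T \in pi by rewrite mem_pi mem_head T0 lexx.
have piT : itv_partition 0 T pi.
  split=> //; rewrite eq_le; apply/andP; split.
    have: last 0 pi \in pi by case: (pi) Tpi => //= a b _; rewrite mem_last.
    by rewrite mem_pi => /and3P[].
  move: Tpi pi_lt; case/splitPr => p1 p2; rewrite cat_path last_cat /=.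
  move=> /and3P[_ _ /(order_path_min lt_trans)/allP Tp2].
  by have := mem_last T p2; rewrite inE => /predU1P[->|/Tp2/ltW].
exists pi; split=> //.
- apply: (@le_lt_trans _ _ h); last by rewrite /h; lra.
  apply: bigmax_le => [|k _]; first exact: ltW.
  set tk := tpt T pi k; rewrite lerBlDr.
  have /andP[tk0 tkT] : 0 <= tk <= T by apply: tpt_itv => //; exact: ltnW.
  have /andP[m1 m2] := @truncn_itv _ (tk / h) (divr_ge0 tk0 (ltW h0)).
  move: m1 m2; set m := Num.truncn _ => m1 m2.
  have tkg : tk < h * m.+1%:R by rewrite mulrC -ltr_pdivrMr.
  have gtk : h * m.+1%:R <= h + tk.
    by move: m1; rewrite ler_pdivlMr // -natr1 mulrDr mulr1; lra.
  apply: le_trans gtk; have [gT|Tg] := leP (h * m.+1%:R) T.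
    apply: tpt_gap => //; rewrite /points /= inE mem_pi.
    apply/orP; right; apply/andP; split; last first.
      by rewrite gT andbT (le_lt_trans tk0).
    rewrite inE mem_cat; apply/orP; right; apply/orP; right; apply/mapP.
    exists m.+1 => //; rewrite mem_iota /= add0n ltnS.
    have : m.+1%:R <= T / h by rewrite ler_pdivlMr // mulrC.
    move=> /le_lt_trans/(_ (proj2 (andP (truncn_itv _)))).
    rewrite -/N ltr_nat => /(_ (divr_ge0 (ltW T0) (ltW h0))).
    exact: ltnW.
  apply: le_trans (ltW Tg).
  by have /andP[] := tpt_itv pi k.+1 piT (ltn_ord k).
- move=> x xl; have /andP[x0 xT] := lT x xl.
  rewrite /points /= inE mem_pi; have [->//|xn0] := eqVneq x 0.
  by rewrite inE mem_cat xl /= orbT /= xT lt_neqAle eq_sym xn0 x0.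
Qed.

(** The scheme along tau serves as a reference to which the schemes along pi
    and sigma are both compared. *)
Lemma refinement (pi sigma l : seq R) : 0 < T ->
    itv_partition 0 T pi -> itv_partition 0 T sigma ->
    {in l, forall x, 0 <= x <= T} ->
  exists tau, [/\ itv_partition 0 T tau, points pi `<=` points tau,
                  points sigma `<=` points tau
                & {in l, forall x, points tau x}].
Proof.
move=> T0 piT siT lT.
case: (fine_partition 1 ((0 :: pi) ++ (0 :: sigma) ++ l) T0 ltr01).
  move=> x; rewrite !mem_cat => /or3P[xpi|xsi|xl].
  - exact: (points_itv pi).
  - exact: (points_itv sigma).
  - exact: lT.
move=> tau [tauT _ tauP]; exists tau; split=> // x xP; apply: tauP.
- by rewrite mem_cat xP.
- by rewrite !mem_cat (_ : x \in 0 :: sigma) ?orbT.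
- by rewrite !mem_cat xP !orbT.
Qed.

Lemma mesh_to0_proper : 0 < T -> ProperFilter (mesh_to0 T).
Proof.
move=> T0; apply: Build_ProperFilter_ex => B [eta eta0 etaB].
have [//|pi [piT mpi _]] := fine_partition eta [::] T0 eta0.
by exists pi; exact: etaB.
Qed.

End Partitions.

(** * Almost flows and the Davie estimate *)

Lemma last_true_before (P : nat -> bool) n : (0 < n)%N -> P 0 ->
  exists k, [/\ (k < n)%N, P k & k.+1 = n \/ ~~ P k.+1].
Proof.
elim: n P => // -[|n] IH P _ P0; first by exists 0; split=> //; left.
case: (boolP (P 1)) => P1; last by exists 0; split=> //; right.
have [//|k [kn Pk Pk1]] := IH (fun k => P k.+1) isT.
by exists k.+1; split=> //; case: Pk1 => [->|]; [left|right].
Qed.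

Section AlmostFlow.
Context {R : realType} {V : normedModType R} {T : R} {delta varpi : R -> R}
  {omega : R -> R -> R} {kappa M : R} {phi : R -> R -> V -> V}
  {a : V} {L ell : R}.
Hypothesis delta_nd : nondecreasing_null delta.
Hypothesis varpi_nd : nondecreasing_null varpi.
Hypothesis omega_control : control T omega.
Hypothesis varpi_kappa :
  forall x : R, 0 <= x -> 2 * varpi (x / 2) <= kappa * varpi x.
Hypothesis M_ge0 : 0 <= M.
Hypothesis phi_af : almost_flow T delta varpi omega M phi.
Implicit Types (r s t : R) (b c d : V).

Lemma varpi_ge0 x : 0 <= x -> 0 <= varpi x.
Proof. by case: varpi_nd => _ + _; exact. Qed.

Lemma varpi_le x y : 0 <= x -> x <= y -> varpi x <= varpi y.
Proof. by case: varpi_nd => _ _; exact. Qed.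

Lemma omega_ge0 s t : simplex2 T s t -> 0 <= omega s t.
Proof. by case: omega_control => + _ _ _; exact. Qed.

Lemma omega_super r s t : simplex3 T r s t ->
  omega r s + omega s t <= omega r t.
Proof. by case: omega_control => _ + _ _; exact. Qed.

Lemma omega_refl s : 0 <= s <= T -> omega s s = 0.
Proof. by case: omega_control => _ _ + _; exact. Qed.

Lemma omega_mono r s t u : 0 <= r -> r <= s -> s <= t -> t <= u -> u <= T ->
  omega s t <= omega r u.
Proof.
move=> r0 rs st tu uT.
have rt := le_trans rs st; have su := le_trans st tu.
have s0 := le_trans r0 rs; have t0 := le_trans s0 st; have tT := le_trans tu uT.
have := omega_super r s t; have := omega_super r t u.
have := omega_ge0 r s; have := omega_ge0 t u.
rewrite /simplex2 /simplex3 r0 rs st tu uT rt t0 tT /= (le_trans st tT).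
by move=> /(_ isT) ? /(_ isT) ? /(_ isT) ? /(_ isT) ?; lra.
Qed.

Lemma varpi_omega_ge0 s t : simplex2 T s t -> 0 <= varpi (omega s t).
Proof. by move=> st; apply/varpi_ge0/omega_ge0. Qed.

Lemma delta_ge0 x : 0 <= x -> 0 <= delta x.
Proof. by case: delta_nd => _ + _; exact. Qed.

(** The infimum that defines the norm of class O is a bound itself, because
    every admissible constant dominates the same quotient. *)
Lemma hat_osc r s t lambda b c : simplex3 T r s t -> 0 <= lambda ->
  `|b - c| <= lambda * varpi (omega r s) ->
  `|hat phi t s b - hat phi t s c|
     <= delta T * (1 + lambda) * varpi (omega r t).
Proof.
move=> rst l0 bc; case: phi_af => -[[_ [C0 C0O]] norm1 _] _.
have OE C : O_bound T delta varpi omega (hat phi) C ->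
    `|hat phi t s b - hat phi t s c|
      <= C * (delta T * (1 + lambda) * varpi (omega r t)).
  move=> [_ /(_ r s t lambda rst l0) COb]; rewrite !mulrA -lee_fin.
  by apply: le_trans COb; apply: ereal_sup_ubound; exists (b, c).
have [r0 rs st tT] := and4P rst.
have : 0 <= delta T * (1 + lambda) * varpi (omega r t).
  rewrite !mulr_ge0 ?addr_ge0 // ?delta_ge0 ?varpi_omega_ge0 //.
    by rewrite (le_trans r0) // (le_trans rs) // (le_trans st).
  by rewrite /simplex2 r0 tT (le_trans rs).
rewrite le_eqVlt => /predU1P[E|lt0].
  by have := OE _ C0O; rewrite -E mulr0.
rewrite -[leRHS]mul1r -ler_pdivrMr //; apply: le_trans norm1.
apply: lb_le_inf; first by exists C0.
by move=> C /OE; rewrite ler_pdivrMr.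
Qed.

Lemma hat_le s t b : simplex2 T s t -> `|hat phi t s b| <= delta (t - s).
Proof.
move=> st; case: phi_af => -[_ _ /(_ s t st) hle] _.
exact: (unorm_leP _ _ _ b hle).
Qed.

Lemma phi_refl t b : 0 <= t <= T -> phi t t b = b.
Proof.
move=> tT; have := @hat_le t t b; rewrite /simplex2 lexx subrr.
case: delta_nd => -> _ _ /(_ tT); rewrite normr_le0 subr_eq0.
by move/eqP.
Qed.

Lemma almost_flow_le r s t b : simplex3 T r s t ->
  `|phi t s (phi s r b) - phi t r b| <= M * varpi (omega r t).
Proof.
move=> rst; case: phi_af => _ /(_ r s t rst) flow.
exact: (unorm_leP _ _ _ b flow).
Qed.

Lemma phi_continuous s t : simplex2 T s t -> continuous (phi t s).
Proof.
move=> st; case: phi_af => -[[/(_ s t st) hat_cont _] _ _] _ b.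
have -> : phi t s = (fun x => hat phi t s x + x).
  by apply/funext => x; rewrite /hat subrK.
by apply: cvgD; [exact: hat_cont|exact: cvg_id].
Qed.

(** Insert phi t s (phi s r b) and phi t s c: the flow property fails by at
    most M varpi, and phi t s = id + hat moves the defect on [r, s] by itself
    plus an oscillation of the hat part. *)
Lemma defect_subadd r s t lambda b c d : simplex3 T r s t -> 0 <= lambda ->
  `|c - phi s r b| <= lambda * varpi (omega r s) ->
  `|d - phi t r b| <= `|c - phi s r b| + `|d - phi t s c|
     + (delta T * (1 + lambda) + M) * varpi (omega r t).
Proof.
move=> rst l0 bc.
have hatB : phi t s c - phi t s (phi s r b)
    = (c - phi s r b) + (hat phi t s c - hat phi t s (phi s r b)).
  by rewrite /hat opprB addrACA addKr [c + _]addrC subrK.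
have := ler_distD (phi t s c) d (phi t r b).
have := ler_distD (phi t s (phi s r b)) (phi t s c) (phi t r b).
have := ler_normD (c - phi s r b) (hat phi t s c - hat phi t s (phi s r b)).
rewrite -hatB.
have := hat_osc _ _ _ _ _ _ rst l0 bc; have := almost_flow_le _ _ _ b rst.
by rewrite mulrDl; lra.
Qed.

(** The two outer intervals see at most half of the control, so that together
    they cost kappa K by the hypothesis on varpi; each of the two intermediate
    times costs delta_T (1 + K) + M. *)
Lemma davie_step r s s' t K b c c' d :
  0 <= r -> r <= s -> s <= s' -> s' <= t -> t <= T -> 0 <= K ->
  omega r s <= omega r t / 2 -> omega s' t <= omega r t / 2 ->
  `|c - phi s r b| <= K * varpi (omega r s) ->
  `|c' - phi s' s c| <= K * varpi (omega s s') ->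
  `|d - phi t s' c'| <= K * varpi (omega s' t) ->
  `|d - phi t r b| <= `|c' - phi s' s c|
     + (kappa * K + 2 * (delta T * (1 + K) + M)) * varpi (omega r t).
Proof.
move=> r0 rs ss' s't tT K0 rs2 s't2 bc cc' c'd.
have st := le_trans ss' s't; have rt := le_trans rs st.
have s0 := le_trans r0 rs; have s'0 := le_trans s0 ss'.
have T0 : 0 <= T by exact: le_trans (le_trans s'0 s't) tT.
have rt0 : 0 <= omega r t by rewrite omega_ge0 // /simplex2 r0 rt.
have := @defect_subadd r s t K b c d; rewrite /simplex3 r0 rs st tT.
move=> /(_ isT K0 bc) sub1.
have := @defect_subadd s s' t K c c' d; rewrite /simplex3 s0 ss' s't tT.
move=> /(_ isT K0 cc') sub2.
have half x : 0 <= x -> x <= omega r t / 2 ->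
    2 * (K * varpi x) <= K * (kappa * varpi (omega r t)).
  move=> x0 x2; rewrite mulrCA ler_wpM2l //.
  apply: le_trans (varpi_kappa _ rt0); rewrite ler_pM2l //.
  exact: varpi_le.
have h1 := half _ _ rs2; have h2 := half _ _ s't2.
have N0 : 0 <= delta T * (1 + K) + M.
  by rewrite addr_ge0 // mulr_ge0 ?delta_ge0 // addr_ge0.
have : (delta T * (1 + K) + M) * varpi (omega s t)
    <= (delta T * (1 + K) + M) * varpi (omega r t).
  apply/ler_wpM2l/varpi_le => //; last exact: omega_mono.
  by rewrite omega_ge0 // /simplex2 s0 st.
have {}h1 := h1 (omega_ge0 _ _ _); have {}h2 := h2 (omega_ge0 _ _ _).
move: h1 h2; rewrite /simplex2 r0 rs s'0 s't tT (le_trans st tT) /=.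
move=> /(_ isT) h1 /(_ isT) h2 h3.
by rewrite (mulrDl _ (2 * _)) -mulrA [kappa * _]mulrCA -mulrA; lra.
Qed.

(** The index k is the last one before the control from the start exceeds one
    half of its total. *)
Lemma control_midpoint (u : nat -> R) n : (0 < n)%N -> 0 <= u 0 -> u n <= T ->
    (forall i j, (i <= j <= n)%N -> u i <= u j) ->
  exists2 k, (k < n)%N & omega (u 0) (u k) <= omega (u 0) (u n) / 2 /\
                         omega (u k.+1) (u n) <= omega (u 0) (u n) / 2.
Proof.
move=> n0 u0 unT u_nd.
have uT k : (k <= n)%N -> 0 <= u k <= T.
  move=> kn; rewrite (le_trans u0) ?u_nd ?leq0n //=.
  by apply: le_trans unT; rewrite u_nd // kn leqnn.
have om0 : 0 <= omega (u 0) (u n).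
  by rewrite omega_ge0 // /simplex2 u0 unT u_nd // leqnn.
pose P k := omega (u 0) (u k) <= omega (u 0) (u n) / 2.
have P0 : P 0 by rewrite /P omega_refl ?uT //; lra.
have [k [kn Pk Pk1]] := @last_true_before P n n0 P0.
exists k => //; split=> //; case: Pk1 => [->|].
  by rewrite omega_refl ?uT //; lra.
rewrite /P -ltNge => kgt.
have := omega_super (u 0) (u k.+1) (u n).
by rewrite /simplex3 u0 unT !u_nd ?leqnn ?kn //= => /(_ isT); lra.
Qed.

(** * Smallness on fine partitions *)

Hypothesis T_gt0 : 0 < T.
Hypothesis kappa01 : 0 < kappa < 1.

Lemma omega_0T_ge0 : 0 <= omega 0 T.
Proof. by rewrite omega_ge0 // /simplex2 !lexx ltW. Qed.

Lemma varpi_half (x : R) : 0 <= x -> varpi x <= kappa * varpi (2 * x) / 2.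
Proof.
move=> x0; rewrite ler_pdivlMr // mulrC.
have := @varpi_kappa (2 * x); rewrite mulrAC mulfV // mul1r; apply.
by rewrite mulr_ge0.
Qed.

(** Every halving of x multiplies the ratio varpi x / x by at most kappa.
    The case n = 0, which bounds the ratio on ]0, 1], comes from doubling x
    until it exceeds one half. *)
Lemma varpi_geometric n (x : R) : 0 <= x -> 2 ^+ n * x <= 1 ->
  varpi x <= kappa ^+ n * (2 * varpi 1 * x).
Proof.
have [k0 k1] := andP kappa01.
have w1 : 0 <= varpi 1 by exact: varpi_ge0.
elim: n x => [|n IH] x x0; last first.
  have x20 : 0 <= 2 * x by rewrite mulr_ge0.
  rewrite exprSr -mulrA => /(IH _ x20) IHx.
  apply: le_trans (varpi_half _ x0) _; rewrite exprS.
  rewrite -(mulrA kappa (varpi _)) -(mulrA kappa (kappa ^+ n)).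
  rewrite ler_wpM2l ?(ltW k0) // ler_pdivrMr //; apply: le_trans IHx _.
  by rewrite le_eqVlt; apply/orP; left; apply/eqP; ring.
rewrite expr0 !mul1r => x1.
have [->|xn0] := eqVneq x 0; first by case: varpi_nd => ->; rewrite mulr0.
have {}xn0 : 0 < x by rewrite lt_neqAle eq_sym xn0.
have [m] : exists m, 1 <= 2 ^+ m * x.
  exists (Num.truncn x^-1).+1; rewrite -ler_pdivrMr // mul1r.
  have x'0 : 0 <= x^-1 by rewrite invr_ge0.
  have /andP[_ /ltW/le_trans] := truncn_itv x'0.
  by apply; rewrite -natrX ler_nat ltnW // ltn_expl.
elim: m x x0 x1 xn0 => [|m IH] x x0 x1 xn0.
  rewrite expr0 mul1r => x1'.
  by apply: le_trans (varpi_le _ _ x0 x1) _; nra.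
rewrite exprSr -mulrA => xm.
have [x2|x2] := lerP (1 / 2) x.
  by apply: le_trans (varpi_le _ _ x0 x1) _; nra.
have {}IH : varpi (2 * x) <= 2 * varpi 1 * (2 * x) by apply: IH => //; lra.
apply: le_trans (varpi_half _ x0) _; rewrite ler_pdivrMr //.
have := varpi_ge0 (2 * x); rewrite mulr_ge0 // => /(_ isT) w2.
by apply: le_trans (_ : varpi (2 * x) <= _); [nra|lra].
Qed.

Lemma varpi_sublinear e : 0 < e ->
  exists2 d, 0 < d & forall x, 0 <= x -> x < d -> varpi x <= e * x.
Proof.
move=> e0; have [k0 k1] := andP kappa01.
have w1 : 0 <= varpi 1 by exact: varpi_ge0.
have : (kappa ^+ n * (2 * varpi 1) @[n --> \oo] --> 0 * (2 * varpi 1)).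
  by apply: cvgMl; apply: cvg_expr; rewrite ger0_norm // ltW.
rewrite mul0r => /cvgrPdist_le /(_ e e0) [n _ /(_ n (leqnn n))] /=.
rewrite sub0r normrN ger0_norm ?mulr_ge0 ?exprn_ge0 ?(ltW k0) // => kn.
exists (2 ^- n); first by rewrite invr_gt0 exprn_gt0.
move=> x x0 xn; apply: le_trans (varpi_geometric n x x0 _) _.
  by rewrite mulrC -ler_pdivlMr ?exprn_gt0 // mul1r ltW.
by rewrite mulrA ler_wpM2r.
Qed.

(** Compactness turns the continuity of the control at the diagonal points into
    a uniform modulus. *)
Lemma omega_small e : 0 < e -> exists2 eta, 0 < eta &
  forall s t, simplex2 T s t -> t - s < eta -> omega s t < e.
Proof.
move=> e0; case: omega_control => _ _ _ [eta eta0 /subspace_continuousP omc].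
pose P (d s : R) := forall t, simplex2 T s t -> t - s < d -> omega s t < e.
have : \forall d \near 0^'+, `[0, T] `<=` P d.
  have cover := (compact_near_coveringP _).1 (@segment_compact R 0 T).
  apply: (cover R 0^'+ P) => x.
  rewrite /= in_itv /= => xT.
  have xx : simplex2 T x x && (x - x < eta).
    by rewrite subrr eta0 /simplex2 lexx; move: xT => /andP[-> ->].
  have /cvgrPdist_lt /(_ e e0) := omc (x, x) xx.
  rewrite /from_subspace /= omega_refl // => /nbhs_ballP[d /= d0 dP].
  exists (ball x (d / 2), [set d' | d' < d / 2 /\ d' < eta]).
    split; first by apply: nbhsx_ballx; rewrite divr_gt0.
    by apply: filterI; apply: nbhs_right_lt; rewrite ?divr_gt0.
  move=> [x' d'] /= [xx' [d'd d'eta]] t st td'.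
  move: (xx'); rewrite /ball /= => xx''.
  have := dP (x', t); rewrite sub0r normrN /= => dPt.
  apply: le_lt_trans (ler_norm _) _; apply: dPt.
    move/and3P: st => [_ x't _].
    split; rewrite /ball /=; first by apply: lt_trans xx'' _; lra.
    apply: le_lt_trans (ler_distD x' _ _) _.
    rewrite [`|x' - t|]distrC (ger0_norm (_ : 0 <= t - x')) ?subr_ge0 //.
    lra.
  by rewrite st /=; apply: lt_trans td' _.
move=> /(filterI (nbhs_right_gt 0))/filter_ex[d [d0 dP]].
exists d => // s t st; apply: dP => //=; rewrite in_itv /=.
by move: st => /and3P[-> /le_trans/[apply]].
Qed.

Lemma varpi_omega_small e : 0 < e -> exists2 eta, 0 < eta &
  forall s t, simplex2 T s t -> t - s < eta -> varpi (omega s t) <= e.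
Proof.
move=> e0; have [d d0 dP] := varpi_sublinear _ e0.
have m0 : 0 < Num.min 1 d by rewrite lt_min ltr01.
have [eta eta0 etaP] := omega_small _ m0.
exists eta => // s t st /(etaP s t st); rewrite lt_min => /andP[om1 omd].
have o0 := omega_ge0 s t st.
by apply: le_trans (dP _ o0 omd) _; rewrite ger_pMr // ltW.
Qed.

Lemma mu_ge0 pi : 0 <= mu T varpi omega pi.
Proof. exact: bigmax_ge_id. Qed.

Lemma varpi_le_mu pi k : itv_partition 0 T pi -> (k < size pi)%N ->
  varpi (omega (tpt T pi k) (tpt T pi k.+1))
    <= mu T varpi omega pi * omega (tpt T pi k) (tpt T pi k.+1).
Proof.
move=> piT kn.
have st := tpt_simplex2 pi k piT kn.
have := omega_ge0 _ _ st; rewrite le_eqVlt => /predU1P[<-|o0].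
  by case: varpi_nd => -> _ _; rewrite mulr0.
rewrite -ler_pdivrMr //.
exact: (le_bigmax _ (fun i : 'I_(size pi) => _) (Ordinal kn)).
Qed.

Lemma mu_small e : 0 < e -> exists2 eta, 0 < eta &
  forall pi, itv_partition 0 T pi -> mesh T pi < eta ->
    mu T varpi omega pi <= e.
Proof.
move=> e0; have [d d0 dP] := varpi_sublinear _ e0.
have [eta eta0 etaP] := omega_small _ d0.
exists eta => // pi piT mpi; apply: bigmax_le => [|k _]; first exact: ltW.
have st := tpt_simplex2 pi k piT (ltn_ord k).
have o0 := omega_ge0 _ _ st.
have [->|on0] := eqVneq (omega (tpt T pi k) (tpt T pi k.+1)) 0.
  by rewrite invr0 mulr0 ltW.
rewrite ler_pdivrMr ?lt_neqAle ?o0 1?eq_sym ?on0 //; apply: dP => //.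
by apply: etaP => //; apply: le_lt_trans mpi; exact: mesh_ge.
Qed.

(** * Improving the defect constant to L *)

Hypothesis L_ge0 : 0 <= L.
Hypothesis L_fix : kappa * L + 2 * (delta T * (1 + L) + M) = L.
Hypothesis kappa_delta : kappa + 2 * delta T < 1.

(** Induction on the number of steps between the two times: at the splitting
    index of control_midpoint the one-step defect of the scheme vanishes, and L
    is the fixed point of the recursion on constants. *)
Lemma discrete_davie pi (y : R -> V) i j : itv_partition 0 T pi ->
    (forall k, (k < size pi)%N ->
       y (tpt T pi k.+1) = phi (tpt T pi k.+1) (tpt T pi k) (y (tpt T pi k))) ->
    (i <= j <= size pi)%N ->
  `|y (tpt T pi j) - phi (tpt T pi j) (tpt T pi i) (y (tpt T pi i))|
    <= L * varpi (omega (tpt T pi i) (tpt T pi j)).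
Proof.
move=> piT yS; move eqn : (j - i)%N => n.
elim/ltn_ind: n i j eqn => n IH i j eqn /andP[ij jn].
have tle k l : (k <= l)%N -> (l <= size pi)%N -> tpt T pi k <= tpt T pi l.
  exact: tpt_le.
have t_itv k : (k <= size pi)%N -> 0 <= tpt T pi k <= T by exact: tpt_itv.
have wge0 k l : (k <= l)%N -> (l <= size pi)%N ->
    0 <= L * varpi (omega (tpt T pi k) (tpt T pi l)).
  move=> kl ln; apply/mulr_ge0/varpi_omega_ge0 => //; rewrite /simplex2 tle //.
  have /andP[-> _] := t_itv k (leq_trans kl ln).
  by have /andP[_ ->] := t_itv l ln.
have [n0|n0] := posnP n.
  have -> : i = j by apply/eqP; rewrite eqn_leq ij -subn_eq0 eqn n0.
  by rewrite phi_refl ?t_itv // subrr normr0 wge0.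
have /= := @control_midpoint (fun k => tpt T pi (i + k)) n n0.
rewrite addn0 (_ : i + n = j)%N; last by rewrite -eqn subnKC.
case=> [|||k kn []].
- by have /andP[] := t_itv i (leq_trans ij jn).
- by have /andP[] := t_itv j jn.
- move=> k l /andP[kl ln]; apply: tle; rewrite ?leq_add2l //.
  by apply: leq_trans jn; rewrite -(subnKC ij) leq_add2l eqn.
rewrite addnS => ik kj.
have ikj : (i + k < j)%N by rewrite -(subnKC ij) ltn_add2l eqn.
have yk0 : y (tpt T pi (i + k).+1)
    - phi (tpt T pi (i + k).+1) (tpt T pi (i + k)) (y (tpt T pi (i + k))) = 0.
  by rewrite yS ?subrr // (leq_trans ikj).
have := @davie_step (tpt T pi i) (tpt T pi (i + k)) (tpt T pi (i + k).+1)
  (tpt T pi j) L (y (tpt T pi i)) (y (tpt T pi (i + k)))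
  (y (tpt T pi (i + k).+1)) (y (tpt T pi j)).
rewrite yk0 normr0 add0r L_fix; apply => //.
- by have /andP[] := t_itv i (leq_trans ij jn).
- by rewrite tle ?leq_addr // (leq_trans (ltnW ikj)).
- by rewrite tle // (leq_trans ikj).
- by rewrite tle.
- by have /andP[] := t_itv j jn.
- by apply: IH kn _ _ _ _; rewrite ?addKn // leq_addr (leq_trans (ltnW ikj)).
- by rewrite wge0 // (leq_trans ikj).
- apply: (IH (j - (i + k).+1)%N) => //; last by rewrite ikj.
  have ij' : (i < j)%N by rewrite (leq_ltn_trans _ ikj) ?leq_addr.
  by rewrite -eqn ltn_sub2l // ltnS leq_addr.
Qed.

Definition defect_le (K : R) (y : R -> V) := forall s t, simplex2 T s t ->
  `|y t - phi t s (y s)| <= K * varpi (omega s t).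

(** Without a partition the defect on a small middle interval does not vanish,
    but it is arbitrarily small. *)
Lemma defect_improve K (y : R -> V) : 0 <= K -> defect_le K y ->
  defect_le (kappa * K + 2 * (delta T * (1 + K) + M)) y.
Proof.
move=> K0 yK r t rt; have /and3P[r0 r_t tT] := rt.
apply/ler_addgt0Pr => e e0.
(* K + 1 rather than K, since K may vanish *)
have e'0 : 0 < e / (K + 1) by rewrite divr_gt0 // ltr_wpDl.
have [eta eta0 etaP] := varpi_omega_small _ e'0.
pose n := (Num.truncn ((t - r) / eta)).+1.
have n0 : (0 : R) < n%:R by rewrite ltr0n.
have step : (t - r) / n%:R < eta.
  rewrite ltr_pdivrMr // mulrC -ltr_pdivrMr //.
  have q0 : 0 <= (t - r) / eta by rewrite divr_ge0 ?subr_ge0 // ltW.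
  by have /andP[] := truncn_itv q0.
have step0 : 0 <= (t - r) / n%:R by rewrite divr_ge0 ?subr_ge0.
pose u k := r + (t - r) / n%:R * k%:R.
have u0 : u 0 = r by rewrite /u mulr0 addr0.
have un : u n = t by rewrite /u divfK ?gt_eqF // subrKC.
have u_nd i j : (i <= j <= n)%N -> u i <= u j.
  by move=> /andP[ij _]; rewrite lerD2l ler_wpM2l // ler_nat.
have [|||k kn []] := @control_midpoint u n isT; rewrite ?u0 ?un // => rk kt.
have uS : u k.+1 - u k < eta.
  by rewrite /u opprD addrACA subrr add0r -mulrBr -natrB // subSnn mulr1.
have urt j : (j <= n)%N -> r <= u j <= t.
  by move=> jn; rewrite -{1}u0 -un !u_nd ?jn ?leqnn.
have /andP[ruk ukt] := urt k (ltnW kn); have /andP[ruS uSt] := urt k.+1 kn.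
have ukS : u k <= u k.+1 by rewrite u_nd // leqnSn.
have uk_s : simplex2 T (u k) (u k.+1).
  by rewrite /simplex2 ukS (le_trans r0) //= (le_trans uSt).
have := @davie_step r (u k) (u k.+1) t K (y r) (y (u k)) (y (u k.+1)) (y t).
move=> /(_ r0 ruk ukS uSt tT K0 rk kt).
have rs : simplex2 T r (u k) by rewrite /simplex2 r0 ruk (le_trans ukt).
have st : simplex2 T (u k.+1) t by rewrite /simplex2 uSt tT (le_trans r0).
move=> /(_ (yK _ _ rs) (yK _ _ uk_s) (yK _ _ st)) /le_trans; apply.
rewrite addrC lerD2l; apply: le_trans (yK _ _ uk_s) _.
apply: le_trans (ler_wpM2l K0 (etaP _ _ uk_s uS)) _.
by rewrite mulrCA ger_pMr // ler_pdivrMr ?mul1r ?ltr_wpDl // lerDl.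
Qed.

(** The map of constants in defect_improve is affine with slope
    kappa + 2 delta_T < 1 and fixed point L, so that iterating it brings any
    constant down to L. *)
Lemma defect_le_L K (y : R -> V) : 0 <= K -> defect_le K y -> defect_le L y.
Proof.
move=> K0 yK; pose q := kappa + 2 * delta T.
have dT0 := delta_ge0 T (ltW T_gt0); have [k0 k1] := andP kappa01.
have q0 : 0 <= q by rewrite /q; lra.
have iter n : defect_le (L + q ^+ n * (K - L)) y.
  elim: n => [|n IH]; first by rewrite expr0 mul1r subrKC.
  have -> : L + q ^+ n.+1 * (K - L) = kappa * (L + q ^+ n * (K - L))
      + 2 * (delta T * (1 + (L + q ^+ n * (K - L))) + M).
    by rewrite -{1}L_fix exprS /q; ring.
  apply: defect_improve => //.
  (* a convex combination of L and K *)
  have qn1 : q ^+ n <= 1 by rewrite exprn_ile1 // ltW.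
  have := mulr_ge0 (exprn_ge0 n q0) K0.
  have : 0 <= (1 - q ^+ n) * L by rewrite mulr_ge0 // subr_ge0.
  by move: (q ^+ n) => qn ? ?; lra.
move=> s t st.
have lim : (L + q ^+ n * (K - L)) * varpi (omega s t) @[n --> \oo]
    --> (L + 0 * (K - L)) * varpi (omega s t).
  apply: cvgMl; apply: cvgD; first exact: cvg_cst.
  by apply: cvgMl; apply: cvg_expr; rewrite ger0_norm.
move: lim; rewrite mul0r addr0 => lim.
rewrite -(cvg_lim _ lim) //; apply: limr_ge; first by apply: cvgP lim.
by apply: nearW => n; exact: iter.
Qed.

(** * Stability of the numerical scheme *)

Hypothesis ell_lt1 : ell < 1.
Hypothesis stability : forall pi : seq R, itv_partition 0 T pi ->
  Phi_lipschitz T phi pi (P_part varpi omega pi phi a L) ell.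

Lemma scheme_path_tpt pi k : itv_partition 0 T pi -> (k <= size pi)%N ->
  scheme_path T phi a pi (tpt T pi k) = scheme T phi a pi k.
Proof.
move=> piT kn; rewrite /scheme_path /interpolation count_tpt //.
by rewrite subrr mul0r scale0r addr0.
Qed.

Lemma scheme_path0 pi : itv_partition 0 T pi -> scheme_path T phi a pi 0 = a.
Proof. by move=> piT; rewrite (scheme_path_tpt pi 0). Qed.

Lemma scheme_P_part pi : itv_partition 0 T pi ->
  P_part varpi omega pi phi a L (scheme_path T phi a pi).
Proof.
move=> piT; split; first exact: scheme_path0.
move=> s t /(@pointsP R T)[i si ->] /(@pointsP R T)[j tj ->] st.
have [ij|ji] := leqP i j.
  apply: discrete_davie => //; last by rewrite ij.
  by move=> k kn; rewrite !scheme_path_tpt // ltnW.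
by have := tpt_lt pi j i piT ji si; rewrite ltNge st.
Qed.

Lemma P_part_sub (pi tau : seq R) : points pi `<=` points tau ->
  P_part varpi omega tau phi a L `<=` P_part varpi omega pi phi a L.
Proof.
by move=> pitau y [y0 yP]; split=> // s t /pitau ? /pitau; exact: yP.
Qed.

Lemma defect_P_part pi (y : R -> V) : itv_partition 0 T pi -> y 0 = a ->
  defect_le L y -> P_part varpi omega pi phi a L y.
Proof.
move=> piT y0 yL; split=> // s t /(points_itv pi s piT)/andP[s0 _].
move=> /(points_itv pi t piT)/andP[_ tT] st; apply: yL.
by rewrite /simplex2 s0 st.
Qed.

(** Both the scheme and y are recovered from their hat increments, the scheme
    exactly and y up to the sum of the one-step defects. Since the ratio
    varpi x / x is at most mu along pi and the control is superadditive, that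
    sum is at most L mu omega_{0,T}; stability absorbs the rest. *)
Lemma scheme_stability pi (y : R -> V) x : itv_partition 0 T pi ->
    P_part varpi omega pi phi a L y -> points pi x ->
  `|scheme_path T phi a pi x - y x|
    <= L / (1 - ell) * mu T varpi omega pi * omega 0 T.
Proof.
move=> piT yP xpi; set z := scheme_path T phi a pi.
have zP : P_part varpi omega pi phi a L z by exact: scheme_P_part.
set m := mu _ _ _ _; have m0 : 0 <= m by exact: mu_ge0.
have t_itv k : (k <= size pi)%N -> 0 <= tpt T pi k <= T by exact: tpt_itv.
have sum_defect j : (j <= size pi)%N ->
    `|(z (tpt T pi j) - y (tpt T pi j))
      - (Phi T phi pi 0 j z - Phi T phi pi 0 j y)|
      <= L * m * omega 0 (tpt T pi j).
  elim: j => [|j IH] jn.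
    rewrite /Phi !big_geq // !subrr subr0 zP.1 yP.1 subrr normr0.
    by rewrite omega_refl ?mulr0 // lexx ltW.
  have {}IH := IH (ltnW jn).
  have tj := t_itv j (ltnW jn); have tj1 := t_itv j.+1 jn.
  have tt : tpt T pi j <= tpt T pi j.+1 by rewrite (tpt_le pi j j.+1).
  have zS : z (tpt T pi j.+1) = z (tpt T pi j)
      + hat phi (tpt T pi j.+1) (tpt T pi j) (z (tpt T pi j)).
    by rewrite /hat subrKC /z !scheme_path_tpt // ltnW.
  have yS := yP.2 _ _ (points_tpt pi j (ltnW jn)) (points_tpt pi j.+1 jn) tt.
  have mS := varpi_le_mu pi j piT jn.
  have := omega_super 0 (tpt T pi j) (tpt T pi j.+1).
  rewrite /simplex3 lexx tt; case/andP: tj => -> _; case/andP: tj1 => _ -> /=.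
  move=> /(_ isT) oS.
  rewrite /Phi !big_nat_recr //= -/(Phi T phi pi 0 j z) -/(Phi T phi pi 0 j y).
  set X := (X in `|X|).
  have -> : X = ((z (tpt T pi j) - y (tpt T pi j))
      - (Phi T phi pi 0 j z - Phi T phi pi 0 j y))
      - (y (tpt T pi j.+1) - phi (tpt T pi j.+1) (tpt T pi j) (y (tpt T pi j))).
    rewrite {}/X zS; set hz := hat phi _ _ (z _); rewrite /hat.
    move: (phi _ _ _) (Phi _ _ _ _ _ z) (Phi _ _ _ _ _ y) => p A B.
    move: (z _) (y (tpt T pi j)) (y (tpt T pi j.+1)) hz => u v w h.
    rewrite (addrAC u) (addrAC A) opprD addrACA subrr addr0 !opprB !addrA.
    by rewrite [LHS](ACl (1*5*3*6*4*2)%AC).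
  apply: le_trans (ler_normB _ _) _.
  apply: le_trans (_ : L * m * omega 0 (tpt T pi j)
    + L * m * omega (tpt T pi j) (tpt T pi j.+1) <= _).
    apply: lerD => //; apply: le_trans yS _.
    by rewrite -mulrA ler_wpM2l.
  by rewrite -mulrDr ler_wpM2l // mulr_ge0.
(* the uniform distance is finite, so that ell N can be moved across *)
pose N := unorm (points pi) (fun t => z t - y t).
have Nfin : N = (fine N)%:E.
  rewrite fineK // ge0_fin_numE; last first.
    by apply: le_trans (le_unorm _ _ 0 (points0 pi)); rewrite lee_fin.
  apply: le_lt_trans (ltry (\sum_(t <- 0 :: pi) `|z t - y t|)).
  apply: unorm_le => t tpi; rewrite (big_rem t) //= lerDl.
  exact: sumr_ge0.
have om0 := omega_0T_ge0.
have N_le : fine N <= ell * fine N + L * m * omega 0 T.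
  rewrite -lee_fin -Nfin; apply: unorm_le => t /(@pointsP R T)[j jn ->].
  rewrite -[z _ - _](subrK (Phi T phi pi 0 j z - Phi T phi pi 0 j y)) addrC.
  apply: le_trans (ler_normD _ _) _; apply: lerD.
    have := stability pi piT z y zP yP.
    rewrite -/N Nfin -EFinM => Phi_le; exact: (unorm_leP _ _ _ j Phi_le).
  apply: le_trans (sum_defect j jn) _; rewrite ler_wpM2l ?mulr_ge0 //.
  by have /andP[t0 tT] := t_itv j jn; exact: omega_mono.
apply: le_trans (unorm_leP (points pi) (fun t => z t - y t) (fine N) x _ xpi) _.
  by rewrite -Nfin.
have l0 : 0 < 1 - ell by rewrite subr_gt0.
by rewrite mulrAC -!mulrA [(1 - ell)^-1 * _]mulrC !mulrA ler_pdivlMr //; lra.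
Qed.

(** Compare both schemes with the scheme along a common refinement. *)
Lemma scheme_dist_le (pi sigma : seq R) x : itv_partition 0 T pi ->
    itv_partition 0 T sigma -> points pi x -> points sigma x ->
  `|scheme_path T phi a sigma x - scheme_path T phi a pi x|
    <= 2 * L / (1 - ell)
       * Num.max (mu T varpi omega pi) (mu T varpi omega sigma) * omega 0 T.
Proof.
move=> piT siT xpi xsi.
have [//|tau [tauT pitau sitau _]] := refinement pi sigma [::] T_gt0 piT siT.
have tauP := scheme_P_part tau tauT.
have := scheme_stability pi _ x piT (P_part_sub _ _ pitau _ tauP) xpi.
have := scheme_stability sigma _ x siT (P_part_sub _ _ sitau _ tauP) xsi.
set y := scheme_path T phi a tau.
have := ler_distD (y x) (scheme_path T phi a sigma x)
  (scheme_path T phi a pi x).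
rewrite [`|y x - _|]distrC.
have om0 := omega_0T_ge0.
have C0 : 0 <= L / (1 - ell) by rewrite divr_ge0 // subr_ge0 ltW.
set m1 := mu _ _ _ pi; set m2 := mu _ _ _ sigma.
have max_mono m : m <= Num.max m1 m2 ->
    L / (1 - ell) * m * omega 0 T <= L / (1 - ell) * Num.max m1 m2 * omega 0 T.
  by move=> mle; rewrite ler_wpM2r // ler_wpM2l.
have := max_mono m1; have := max_mono m2; rewrite !le_max !lexx orbT /=.
move=> /(_ isT) ? /(_ isT) ? ? ? ?.
have -> : 2 * L / (1 - ell) = L / (1 - ell) + L / (1 - ell) by ring.
by rewrite !mulrDl; lra.
Qed.

Lemma increment_le K (y : R -> V) s t : simplex2 T s t ->
    `|y t - phi t s (y s)| <= K * varpi (omega s t) ->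
  `|y t - y s| <= K * varpi (omega s t) + delta (t - s).
Proof.
move=> st yst; apply: le_trans (ler_distD (phi t s (y s)) _ _) _.
by apply: lerD => //; exact: hat_le.
Qed.

(** * Convergence of the schemes as the mesh tends to 0 *)

Hypothesis delta_cvg : delta x @[x --> 0^'+] --> 0.

Lemma delta_small e : 0 < e -> exists2 eta, 0 < eta &
  forall x, 0 <= x -> x < eta -> delta x <= e.
Proof.
move=> e0; have /cvgrPdist_le /(_ e e0) [eta /= eta0 etaP] := delta_cvg.
exists eta => // x; rewrite le_eqVlt => /predU1P[<- _|x0 xeta].
  by case: delta_nd => -> _ _; exact: ltW.
have := etaP x; rewrite /= !sub0r !normrN gtr0_norm // => /(_ xeta x0).
by rewrite ger0_norm // delta_ge0 // ltW.
Qed.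

Lemma increment_small K e : 0 <= K -> 0 < e -> exists2 eta, 0 < eta &
  forall (y : R -> V) s t, simplex2 T s t -> t - s < eta ->
    `|y t - phi t s (y s)| <= K * varpi (omega s t) -> `|y t - y s| <= e.
Proof.
move=> K0 e0.
have [d d0 dP] := delta_small (e / 2) (divr_gt0 e0 (ltr0n _ 2)).
have K1 : 0 < e / 2 / (K + 1) by rewrite !divr_gt0 // ltr_wpDl.
have [d' d'0 d'P] := varpi_omega_small _ K1.
exists (Num.min d d'); first by rewrite lt_min d0.
move=> y s t st; rewrite lt_min => /andP[tsd tsd'] /(increment_le _ _ _ _ st).
move=> /le_trans; apply; rewrite [e]splitr; apply: lerD; last first.
  by apply: dP => //; case/and3P: st => _; rewrite subr_ge0.
apply: le_trans (ler_wpM2l K0 (d'P _ _ st tsd')) _.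
by rewrite mulrCA ger_pMr ?divr_gt0 // ler_pdivrMr ?mul1r ?ltr_wpDl // lerDl.
Qed.

Lemma defect_continuous K (y : R -> V) : 0 <= K -> defect_le K y ->
  {within `[0, T], continuous y}.
Proof.
move=> K0 yK; apply/subspace_continuousP => x xT.
apply/cvgrPdist_le => e e0; have [eta eta0 etaP] := increment_small K e K0 e0.
exists eta => // t /= xt tT; move: xT tT; rewrite /= !in_itv /=.
have {}xt : `|x - t| < eta by exact: xt.
move=> /andP[x0 xT] /andP[t0 tT]; have [x_t|/ltW t_x] := lerP x t.
  have st : simplex2 T x t by rewrite /simplex2 x0 x_t.
  rewrite distrC; apply: etaP (st) _ (yK _ _ st).
  by apply: le_lt_trans xt; rewrite distrC ler_norm.
have ts : simplex2 T t x by rewrite /simplex2 t0 t_x.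
apply: etaP (ts) _ (yK _ _ ts).
by apply: le_lt_trans xt; exact: ler_norm.
Qed.

(** Between two consecutive points of pi the interpolated scheme moves by at
    most delta of the mesh, and y by a comparably small amount; at the points
    of pi stability applies. It is enough that y have small defects at the
    points of pi and at t, so that y can be a path or the scheme along any
    partition containing these points. *)
Lemma scheme_near e : 0 < e -> exists2 eta, 0 < eta &
  forall pi (y : R -> V) t, itv_partition 0 T pi -> mesh T pi < eta ->
    P_part varpi omega pi phi a L y -> 0 <= t <= T ->
    (forall s, points pi s -> s <= t ->
       `|y t - phi t s (y s)| <= L * varpi (omega s t)) ->
    `|scheme_path T phi a pi t - y t| <= e.
Proof.
move=> e0; have e3 : 0 < e / 3 by rewrite divr_gt0.
have [d1 d10 d1P] := delta_small _ e3.
have [d2 d20 d2P] := increment_small L _ L_ge0 e3.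
pose C := L / (1 - ell) * omega 0 T.
have C0 : 0 <= C.
  by rewrite mulr_ge0 ?omega_0T_ge0 // divr_ge0 // subr_ge0 ltW.
have e3C : 0 < e / 3 / (C + 1) by rewrite divr_gt0 // ltr_wpDl.
have [d3 d30 d3P] := mu_small _ e3C.
exists (Num.min d1 (Num.min d2 d3)); first by rewrite !lt_min d10 d20.
move=> pi y t piT; rewrite !lt_min => /and3P[m1 m2 m3] yP tT yt.
have at_points x : points pi x -> `|scheme_path T phi a pi x - y x| <= e / 3.
  move=> xpi; apply: le_trans (scheme_stability pi y x piT yP xpi) _.
  rewrite mulrAC -/C; apply: le_trans (ler_wpM2l C0 (d3P pi piT m3)) _.
  by rewrite mulrCA ger_pMr // ler_pdivrMr ?mul1r ?ltr_wpDl // lerDl.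
have [tT'|Tt] := ltP t T; last first.
  have -> : t = tpt T pi (size pi).
    by apply/eqP; rewrite tpt_size // eq_le Tt; case/andP: tT => _ ->.
  by apply: le_trans (at_points _ (@points_tpt R T pi _ (leqnn _))) _; lra.
have t0T : 0 <= t < T by rewrite tT'; case/andP: tT => ->.
have [] := count_itv pi t piT t0T; set k := count _ _ => kn /andP[kt tk1].
have := at_points _ (@points_tpt R T pi k (ltnW kn)).
rewrite scheme_path_tpt ?(ltnW kn) // => near_k.
have mk := @mesh_ge R T pi k kn.
have /andP[tk0 tkT] := tpt_itv pi k piT (ltnW kn).
have /andP[tk10 tk1T] := tpt_itv pi k.+1 piT kn.
have tkk1 : tpt T pi k < tpt T pi k.+1 by exact: le_lt_trans tk1.
have y_near : `|y t - y (tpt T pi k)| <= e / 3.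
  apply: d2P; last by apply: yt => //; exact: points_tpt (ltnW kn).
    by rewrite /simplex2 tk0 kt; case/andP: tT => _ ->.
  by apply: le_lt_trans m2; lra.
have step : `|scheme T phi a pi k.+1 - scheme T phi a pi k| <= e / 3.
  have st : simplex2 T (tpt T pi k) (tpt T pi k.+1).
    by rewrite /simplex2 tk0 tk1T ltW.
  apply: le_trans (hat_le _ _ _ st) _.
  apply: d1P; rewrite ?subr_ge0 ?(ltW tkk1) //.
  exact: le_lt_trans m1.
rewrite /scheme_path /interpolation -/k.
set th := (t - tpt T pi k) / _.
have th0 : 0 <= th by rewrite divr_ge0 // subr_ge0 // ltW.
have th1 : th <= 1 by rewrite ler_pdivrMr ?subr_gt0 // mul1r; lra.
have -> : e = e / 3 + e / 3 + e / 3 by lra.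
rewrite -addrA (addrC (th *: _)) addrA; apply: le_trans (ler_normD _ _) _.
apply: lerD; last first.
  rewrite normrZ ger0_norm //; apply: le_trans step.
  by rewrite ler_piMl.
apply: le_trans (ler_distD (y (tpt T pi k)) _ _) _; apply: lerD => //.
by rewrite distrC.
Qed.

(** The refinement is made to contain the time t as well, so that scheme_near
    applies at t itself. *)
Lemma scheme_cauchy e : 0 < e -> exists2 eta, 0 < eta &
  forall pi sigma t, itv_partition 0 T pi -> itv_partition 0 T sigma ->
    mesh T pi < eta -> mesh T sigma < eta -> 0 <= t <= T ->
    `|scheme_path T phi a sigma t - scheme_path T phi a pi t| <= e.
Proof.
move=> e0; have e2 : 0 < e / 2 by rewrite divr_gt0.
have [eta eta0 near] := scheme_near _ e2.
exists eta => // pi sigma t piT siT mpi msi tT.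
have [|tau [tauT pitau sitau ttau]] := refinement pi sigma [:: t] T_gt0 piT siT.
  by move=> x; rewrite inE => /eqP->.
have tauP := scheme_P_part tau tauT; set y := scheme_path T phi a tau.
have {}ttau : points tau t by apply: ttau; rewrite inE.
have := near pi y t piT mpi (P_part_sub _ _ pitau _ tauP) tT.
move=> /(_ (fun s spi st => tauP.2 s t (pitau _ spi) ttau st)) n1.
have := near sigma y t siT msi (P_part_sub _ _ sitau _ tauP) tT.
move=> /(_ (fun s ssi st => tauP.2 s t (sitau _ ssi) ttau st)) n2.
apply: le_trans (ler_distD (y t) _ _) _.
by rewrite [`|y t - _|]distrC; lra.
Qed.

(** * The limit of the schemes *)

Context {y : R -> V}.
Hypothesis y_lim : forall t, 0 <= t <= T ->
  scheme_path T phi a pi t @[pi --> mesh_to0 T] --> y t.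

Lemma scheme_limit_near e : 0 < e -> exists2 eta, 0 < eta &
  forall pi t, itv_partition 0 T pi -> mesh T pi < eta -> 0 <= t <= T ->
    `|scheme_path T phi a pi t - y t| <= e.
Proof.
have mesh_pr := mesh_to0_proper T_gt0.
move=> e0; have [eta eta0 etaP] := scheme_cauchy e e0.
exists eta => // pi t piT mpi tT; apply/ler_addgt0Pr => e' e'0.
have fine_sigma : mesh_to0 T
    [set sigma | itv_partition 0 T sigma /\ mesh T sigma < eta].
  by exists eta.
have /cvgrPdist_le /(_ e' e'0) := y_lim t tT.
move=> /(filterI fine_sigma)/filter_ex[sigma [[siT msi] ysi]].
have := etaP sigma pi t siT piT msi mpi tT.
have := ler_distD (scheme_path T phi a sigma t)
  (scheme_path T phi a pi t) (y t).
by rewrite [`|scheme_path T phi a sigma t - y t|]distrC; lra.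
Qed.

(** The defect bound of the schemes passes to the limit along partitions that
    contain the two times considered. *)
Lemma scheme_limit_defect : y 0 = a /\ defect_le L y.
Proof.
have in0T : 0 <= (0 : R) <= T by rewrite lexx ltW.
split.
  apply/esym/eqP; rewrite -subr_eq0 -normr_le0; apply/ler_addgt0Pr => e e0.
  have [eta eta0 etaP] := scheme_limit_near e e0; rewrite add0r.
  have [//|pi [piT mpi _]] := fine_partition eta [::] T_gt0 eta0.
  by rewrite -(scheme_path0 pi piT); exact: etaP.
move=> s t st; apply/ler_addgt0Pr => e e0.
have e2 : 0 < e / 2 by rewrite divr_gt0.
have [s0 s_t tT] := and3P st.
have sT : 0 <= s <= T by rewrite s0 (le_trans s_t).
have {}tT : 0 <= t <= T by rewrite tT (le_trans s0).
have /cvgrPdist_le /(_ _ e2) := phi_continuous _ _ st (y s).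
move=> /nbhs_ballP[d /= d0 dP].
have d2 : 0 < d / 2 by rewrite divr_gt0.
have [eta1 eta10 eta1P] := scheme_limit_near _ e2.
have [eta2 eta20 eta2P] := scheme_limit_near _ d2.
have eta0 : 0 < Num.min eta1 eta2 by rewrite lt_min eta10.
have [|pi [piT]] := fine_partition _ [:: s; t] T_gt0 eta0.
  by move=> x; rewrite !inE => /orP[]/eqP->.
rewrite lt_min => /andP[m1 m2] stpi.
have sP : points pi s by apply: stpi; rewrite !inE eqxx.
have tP : points pi t by apply: stpi; rewrite !inE eqxx orbT.
have := (scheme_P_part pi piT).2 s t sP tP s_t.
have yt := eta1P pi t piT m1 tT.
have ys := eta2P pi s piT m2 sT.
have : `|phi t s (y s) - phi t s (scheme_path T phi a pi s)| <= e / 2.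
  apply: dP; rewrite -ball_normE /= distrC; apply: le_lt_trans ys _; lra.
have := ler_distD (scheme_path T phi a pi t) (y t) (phi t s (y s)).
have := ler_distD (phi t s (scheme_path T phi a pi s))
  (scheme_path T phi a pi t) (phi t s (y s)).
rewrite [`|phi t s (scheme_path T phi a pi s) - _|]distrC.
by rewrite [`|y t - scheme_path T phi a pi t|]distrC; lra.
Qed.

(** A path whose defect bound has an arbitrary constant K has the constant L,
    so the schemes, which converge to y, also approximate it. *)
Lemma P_path_unique : P_path T varpi omega phi a =
  [set z : R -> V | forall t, 0 <= t <= T -> z t = y t].
Proof.
have [y0 yL] := scheme_limit_defect.
apply/seteqP; split=> z /=.
  move=> [K /= K0 [_ z0 zK]] t tT.
  have zL : defect_le L z by exact: defect_le_L K0 _.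
  apply/eqP; rewrite -subr_eq0 -normr_le0; apply/ler_addgt0Pr => e e0.
  have e2 : 0 < e / 2 by rewrite divr_gt0.
  have [eta1 eta10 eta1P] := scheme_limit_near _ e2.
  have [eta2 eta20 eta2P] := scheme_near _ e2.
  have eta0 : 0 < Num.min eta1 eta2 by rewrite lt_min eta10.
  have [//|pi [piT + _]] := fine_partition _ [::] T_gt0 eta0.
  rewrite lt_min => /andP[m1 m2]; have yt := eta1P pi t piT m1 tT.
  have zt := eta2P pi z t piT m2 (defect_P_part pi z piT z0 zL) tT.
  have {}zt : `|scheme_path T phi a pi t - z t| <= e / 2.
    apply: zt => s spi s_t; apply: zL; rewrite /simplex2 s_t.
    by have /andP[-> _] := points_itv pi s piT spi; case/andP: tT => _ ->.
  have := ler_distD (scheme_path T phi a pi t) (z t) (y t).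
  by rewrite [`|z t - scheme_path T phi a pi t|]distrC; lra.
move=> zy; have zL : defect_le L z.
  move=> s t st; have /and3P[s0 s_t tT] := st.
  by rewrite !zy ?s0 ?tT ?(le_trans s0) ?(le_trans s_t) //; exact: yL.
exists L => //; split=> //; first exact: defect_continuous L_ge0 zL.
by rewrite zy // lexx ltW.
Qed.

End AlmostFlow.

Theorem proposition3 (R : realType) (V : completeNormedModType R)
    (T : R) (delta varpi : R -> R) (omega : R -> R -> R) (kappa M : R)
    (phi : R -> R -> V -> V) (a : V) (ell : R)
    (T_gt0 : 0 < T)
    (delta_nd : nondecreasing_null delta)
    (varpi_nd : nondecreasing_null varpi)
    (omega_control : control T omega)
    (kappa01 : 0 < kappa < 1)
    (varpi_kappa : forall x : R, 0 <= x -> 2 * varpi (x / 2) <= kappa * varpi x)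
    (kappa_delta : kappa + 2 * delta T < 1)
    (M_ge0 : 0 <= M)
    (phi_af : almost_flow T delta varpi omega M phi)
    (L := 2 * (delta T + M) / (1 - kappa - 2 * delta T))
    (A := 2 * (delta T * (1 + L) + M) / (1 - kappa))
    (ell_lt1 : ell < 1)
    (stability : forall pi : seq R, itv_partition 0 T pi ->
       Phi_lipschitz T phi pi (P_part varpi omega pi phi a L) ell) :
  [/\ forall (pi : seq R) (y : R -> V), itv_partition 0 T pi -> P_bound T varpi omega phi a L y ->
        (unorm (points pi) (fun t => (scheme_path T phi a pi t - y t)%R)
         <= (A / (1 - ell) * mu T varpi omega pi * omega 0 T)%:E)%E,
      forall sigma pi : seq R, itv_partition 0 T sigma -> itv_partition 0 T pi ->
        (unorm (points sigma `&` points pi)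
           (fun t => (scheme_path T phi a sigma t - scheme_path T phi a pi t)%R)
         <= (2 * A / (1 - ell)
             * Num.max (mu T varpi omega pi) (mu T varpi omega sigma)
             * omega 0 T)%:E)%E
    & delta x @[x --> 0^'+] --> 0 ->
        (forall e : R, 0 < e -> \forall sigma & pi \near mesh_to0 T,
           (unorm `[0%R, T]
              (fun t => (scheme_path T phi a sigma t - scheme_path T phi a pi t)%R)
            <= e%:E)%E) /\
        exists y : R -> V,
          P_path T varpi omega phi a = [set z : R -> V | forall t, 0 <= t <= T -> z t = y t] /\
          unorm `[0%R, T] (fun t => (scheme_path T phi a pi t - y t)%R)
            @[pi --> mesh_to0 T] --> 0%E].
Proof.
have kd0 : 0 < 1 - kappa - 2 * delta T by lra.
have dT0 : 0 <= delta T by exact: delta_ge0 delta_nd _ (ltW T_gt0).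
have L_ge0 : 0 <= L by rewrite divr_ge0 ?(ltW kd0) // mulr_ge0 // addr_ge0.
have L_fix : kappa * L + 2 * (delta T * (1 + L) + M) = L.
  have : L * (1 - kappa - 2 * delta T) = 2 * (delta T + M).
    by rewrite divfK // gt_eqF.
  by clear A; clearbody L => LE; lra.
(* L is the fixed point of the recursion on defect constants, which is why
   the two constants coincide *)
have AL : A = L.
  case/andP: kappa01 => k0 k1.
  by rewrite /A (_ : 2 * _ = L * (1 - kappa)) ?mulfK ?subr_eq0 ?gt_eqF //; lra.
clearbody A; subst A; clearbody L.
split.
- move=> pi y piT [_ y0 yL].
  have yP := defect_P_part pi y piT y0 yL.
  apply: unorm_le => x xpi.
  apply: (scheme_stability (delta := delta) (varpi := varpi) (omega := omega)
    (kappa := kappa) (M := M) (L := L) (ell := ell)) => //.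
- move=> sigma pi siT piT; apply: unorm_le => x [xsi xpi].
  exact: (scheme_dist_le (delta := delta) (varpi := varpi) (omega := omega)
    (kappa := kappa) (M := M) (L := L) (ell := ell)).
move=> delta_cvg.
have cauchy e : 0 < e -> exists2 eta, 0 < eta &
    forall pi sigma t, itv_partition 0 T pi -> itv_partition 0 T sigma ->
      mesh T pi < eta -> mesh T sigma < eta -> 0 <= t <= T ->
      `|scheme_path T phi a sigma t - scheme_path T phi a pi t| <= e.
  exact: (scheme_cauchy (delta := delta) (varpi := varpi) (omega := omega)
    (kappa := kappa) (M := M) (L := L) (ell := ell)).
split.
  move=> e e0; have [eta eta0 etaP] := cauchy e e0.
  pose B := [set pi | itv_partition 0 T pi /\ mesh T pi < eta].
  exists (B, B); first by split; exists eta.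
  move=> [sigma pi] /= [[siT msi] [piT mpi]]; apply: unorm_le => t /=.
  by rewrite in_itv /=; exact: etaP.
have mesh_pr := mesh_to0_proper T_gt0.
pose y t := lim (scheme_path T phi a pi t @[pi --> mesh_to0 T]).
have y_lim t : 0 <= t <= T ->
    scheme_path T phi a pi t @[pi --> mesh_to0 T] --> y t.
  move=> tT; apply: cauchy_cvg; apply: cauchy_exP => e e0.
  have e2 : 0 < e / 2 by rewrite divr_gt0.
  have [eta eta0 etaP] := cauchy _ e2.
  have [//|pi [piT mpi _]] := fine_partition eta [::] T_gt0 eta0.
  exists (scheme_path T phi a pi t); exists eta => // sigma siT msi.
  rewrite -ball_normE /= distrC.
  by apply: le_lt_trans (etaP _ _ t piT siT mpi msi tT) _; lra.
exists y; split.
  exact: (P_path_unique (delta := delta) (varpi := varpi) (omega := omega)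
    (kappa := kappa) (M := M) (L := L) (ell := ell)).
apply/fine_cvgP.
have near_y e : 0 < e -> exists2 eta, 0 < eta &
    forall pi t, itv_partition 0 T pi -> mesh T pi < eta -> 0 <= t <= T ->
      `|scheme_path T phi a pi t - y t| <= e.
  exact: (scheme_limit_near (delta := delta) (varpi := varpi) (omega := omega)
    (kappa := kappa) (M := M) (L := L) (ell := ell)).
pose dist pi := unorm `[0, T] (fun t => scheme_path T phi a pi t - y t).
have unorm_near (e : R) : 0 < e -> \forall pi \near mesh_to0 T,
    (0 <= dist pi <= e%:E)%E.
  move=> e0; have [eta eta0 etaP] := near_y e e0.
  exists eta => // pi piT mpi; apply/andP; split.
    have T0 : `[0, T]%classic 0 by rewrite /= in_itv /= lexx ltW.
    by apply: le_trans (le_unorm _ _ 0 T0); rewrite lee_fin.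
  by apply: unorm_le => t /=; rewrite in_itv /=; exact: etaP.
split.
  near=> pi; have /andP[u0 u1] : (0 <= dist pi <= 1%:E)%E.
    by near: pi; exact: unorm_near.
  by rewrite ge0_fin_numE // (le_lt_trans u1) // ltry.
apply/cvgrPdist_le => e e0; near=> pi.
have /andP[u0 u1] : (0 <= dist pi <= e%:E)%E.
  by near: pi; exact: unorm_near.
rewrite sub0r normrN ger0_norm ?fine_ge0 //= -lee_fin fineK //.
by rewrite ge0_fin_numE // (le_lt_trans u1) // ltry.
Unshelve. all: by end_near.
Qed.
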